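(* Let $\rho$ be a coherent risk measure and let $((\Omega,\mathcal F,\mathbb P),\mathcal P)$ be a coherent market. Suppose the market contains a $\rho$-arbitrage $X$. Then for any random variable $Y$ of finite expectation, with $\tilde u(x):=x^+=\max\{x,0\}$, $$\lim_{\lambda\to\infty}\mathbb E(\tilde u(Y+\lambda X))=\infty,$$ and for all $\lambda\ge 0$, $$\mathcal P(Y+\lambda X)\le \mathcal P(Y),\qquad \rho(Y+\lambda X)\le\rho(Y).$$ If in addition $\mathbb E(X^-)<\infty$, where $X^-=\max\{-X,0\}$, then for every utility function of the form $$u(x):=\begin{cases} C_1x^{a_1} & x\ge 0\\ -C_2(-x)^{a_2} & x\le 0\end{cases}$$ where $C_1>0$, $C_2\ge 0$ and $0<a_2<a_1\le 1$, we have $$\lim_{\lambda\to\infty}\mathbb E(u(Y+\lambda X))=\infty.$$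
   Context: A market consists of a probability space $(\Omega,\mathcal F,\mathbb P)$ and a function $\mathcal P:L^0(\Omega,\mathbb R)\to\mathbb R\cup\{+\infty\}$ (random variables are asset payoffs, $\mathcal P$ gives their price; assets of price $+\infty$ cannot be purchased). It is positive-homogeneous if $\mathcal P(\lambda X)=\lambda\mathcal P(X)$ for $\lambda\ge 0$ (with the convention $0\cdot\infty=0$). It is coherent if it is positive-homogeneous, $\mathcal P(X+Y)\le\mathcal P(X)+\mathcal P(Y)$ for all $X,Y$, and $\mathcal P(1)<\infty$, $\mathcal P(-1)<\infty$. A coherent risk measure is a function $\rho:L^0(\Omega;\mathbb R)\to\mathbb R\cup\{\infty\}$, finite on $L^\infty(\Omega;\mathbb R)$, satisfying: (i) $\rho(0)=0$; (ii) $\rho(X)\ge\rho(Y)$ if $X\le Y$ almost surely; (iii) $\rho(X_1+X_2)\le\rho(X_1)+\rho(X_2)$; (iv) $\rho(X+a)=\rho(X)-a$ for $a\in\mathbb R$; (v) $\rho(\lambda X)=\lambda\rho(X)$ for $\lambda\in\mathbb R^+$. A random variable $X$ is a $\rho$-arbitrage if $\mathcal P(X)\le 0$, $\rho(X)\le 0$ and $\mathbb P(X>0)>0$. Expectations of nonnegative random variables take values in $[0,\infty]$, and the expectations in the claim may take the value $+\infty$. *)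

(* Defs.v *)
From HB Require Import structures.
From mathcomp Require Import all_boot all_order all_algebra generic_quotient.
From mathcomp Require Import all_classical all_reals all_analysis measurable_realfun.

Set Implicit Arguments.
Unset Strict Implicit.
Unset Printing Implicit Defensive.

Import Order.TTheory GRing.Theory Num.Theory.
Import numFieldNormedType.Exports.

Local Open Scope classical_set_scope.
Local Open Scope ring_scope.
Local Open Scope quotient_scope.
Local Open Scope ereal_scope.

Section Market.
Context {d : measure_display} {Omega : measurableType d} {R : realType}.
Variable P : probability Omega R.

Definition L0 : Type := {mfun_ P, Omega >-> R}.

(* L0 carries no algebraic operations: sums, multiples and constants are formed
   on random variables and then sent to their almost sure class. *)
Definition L0_class (X : {RV P >-> R}) : L0 := \pi_{mfun_ P, Omega >-> R} X.

(* A map from L0 to R `|` {+oo}. *)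
Record L0_functional := {
  functional_val :> L0 -> \bar R;
  functional_gtNy : forall X : L0, -oo < functional_val X }.

(* The case lambda = 0 relies on 0 * +oo = 0, which holds in \bar R. *)
Definition L0_positive_homogeneous (F : L0_functional) :=
  forall (lambda : R) (X : {RV P >-> R}), (0 <= lambda)%R ->
    F (L0_class (lambda *: X)%R) = lambda%:E * F (L0_class X).

Definition L0_subadditive (F : L0_functional) :=
  forall X Y : {RV P >-> R},
    F (L0_class (X + Y)%R) <= F (L0_class X) + F (L0_class Y).

Record coherent_market (price : L0_functional) : Prop := {
  market_homogeneous : L0_positive_homogeneous price;
  market_subadditive : L0_subadditive price;
  market_long_bond : price (L0_class (cst 1%R)) < +oo;
  market_short_bond : price (L0_class (cst (-1)%R)) < +oo }.

Record coherent_risk_measure (rho : L0_functional) : Prop := {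
  risk_fin_num : forall X : {RV P >-> R},
    (X : Omega -> R) \in Lfun P +oo -> rho (L0_class X) \is a fin_num;
  risk0 : rho (L0_class (cst 0%R)) = 0;
  risk_antitone : forall X Y : {RV P >-> R},
    {ae P, forall w, (X w <= Y w)%R} -> rho (L0_class Y) <= rho (L0_class X);
  risk_subadditive : L0_subadditive rho;
  risk_cash : forall (X : {RV P >-> R}) (a : R),
    rho (L0_class (X + cst a)%R) = rho (L0_class X) - a%:E;
  risk_homogeneous : L0_positive_homogeneous rho }.

Definition rho_arbitrage (price rho : L0_functional) (X : {RV P >-> R}) :=
  [/\ price (L0_class X) <= 0,
      rho (L0_class X) <= 0 &
      0 < P [set w | (0 < X w)%R]].

End Market.

Definition tilde_u {R : realType} (x : R) : R := Num.max x 0%R.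

Definition power_utility {R : realType} (C1 a1 C2 a2 x : R) : R :=
  (if 0 <= x then C1 * x `^ a1 else - (C2 * (- x) `^ a2))%R.

(* Main.v *)
Require Import Defs.
From HB Require Import structures.
From mathcomp Require Import all_boot all_order all_algebra.
From mathcomp Require Import all_classical all_reals all_analysis measurable_realfun.
From mathcomp Require Import lra.
Import Order.TTheory GRing.Theory Num.Theory.
Import numFieldNormedType.Exports.
Local Open Scope classical_set_scope.
Local Open Scope ring_scope.
Local Open Scope ereal_scope.

(** Truncating the arbitrage to [W := min (X^+) 1] gives an integrable random
    variable with [E W > 0] and, for [lambda >= 1] and [0 < a <= 1],
    [((Y + lambda X)^+)^a >= lambda^a W - |Y|]. The negative part contributes at
    most [lambda^a2 (1 + |Y| + X^-)], which has finite expectation. So the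
    expected utility is at least [c lambda^a1 - D lambda^a2] with [c > 0], and
    [a2 < a1] makes this diverge. For [tilde_u] there is no loss term, so [X^-]
    need not be integrable. *)

(** Positive and negative parts compare in opposite directions, so two comparisons of nonnegative
    integrals suffice. The integral of [f] may be [+oo], as happens for expected utilities. *)
Lemma integral_le_integrable_minorant (d : measure_display)
    (T : measurableType d) (R : realType) (mu : measure T R) (D : set T)
    (f g : T -> \bar R) :
  measurable D -> mu.-integrable D g -> measurable_fun D f ->
  {in D, forall x, g x <= f x} ->
  \int[mu]_(x in D) g x <= \int[mu]_(x in D) f x.
Proof.
move=> mD ig mf gf; have mg := measurable_int mu ig.
rewrite [leLHS]integralE [leRHS]integralE; apply: leeB;
  apply: ge0_le_integral => //.
- exact: measurable_funepos.
- exact: measurable_funepos.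
- by move=> x Dx; rewrite (funepos_le gf)// inE.
- exact: measurable_funeneg.
- exact: measurable_funeneg.
- by move=> x Dx; rewrite (funeneg_le gf)// inE.
Qed.

(** Factor out [l^b]: the remaining [l^(a-b) * c - D] tends to infinity because [a - b > 0]. *)
Lemma near_pinfty_powR_sub_ge {R : realType} (c D a b A : R) :
  (0 < c)%R -> (0 <= b)%R -> (b < a)%R ->
  \forall l \near +oo%R, (A <= l `^ a * c - l `^ b * D)%R.
Proof.
move=> c0 b0 ba.
have ab0 : (0 < a - b)%R by lra.
(* Once [l^(a-b) >= M], the bracket [l^(a-b) * c - D] is at least [|A|]; being nonnegative, this
   bound survives multiplication by [l^b >= 1]. *)
pose M := ((`|A| + `|D|) / c)%R.
have M0 : (0 <= M)%R by rewrite divr_ge0 ?addr_ge0// ltW.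
near=> l.
have l1 : (1 <= l)%R by near: l; apply: nbhs_pinfty_ge; rewrite num_real.
have lM : (M `^ (a - b)^-1 <= l)%R.
  by near: l; apply: nbhs_pinfty_ge; rewrite num_real.
have l0 : (0 < l)%R by lra.
have Ml : (M <= l `^ (a - b))%R.
  have -> : M = (M `^ (a - b)^-1 `^ (a - b))%R.
    by rewrite -powRrM mulVf ?gt_eqF// powRr1.
  by apply: ge0_ler_powR => //; rewrite ?nnegrE ?powR_ge0 ?ltW.
have lb1 : (1 <= l `^ b)%R by rewrite -(powRr0 l) ler_powR.
have -> : (l `^ a = l `^ b * l `^ (a - b))%R.
  by rewrite -powRD; [rewrite addrC subrK | rewrite (gt_eqF l0) implybT].
have : (`|A| + `|D| <= l `^ (a - b) * c)%R by rewrite -ler_pdivrMr.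
have := ler_norm A; have := ler_norm D; have := normr_ge0 A.
set p := (l `^ b)%R in lb1 *; set q := (l `^ (a - b))%R.
move=> nA nD Ab h.
have : (`|A| <= p * `|A|)%R by rewrite ler_peMl.
have : (p * `|A| <= p * (q * c - D))%R by rewrite ler_pM2l; lra.
lra.
Unshelve. all: by end_near. Qed.

(** Integrating the pointwise bound reduces the limit to the growth of [l^a E(W) - l^b E(G)]. The
    case [b = 0] serves [tilde_u], and [b = a2] the power utility. *)
Lemma cvg_expectation_powR_minorant (d : measure_display)
    (T : measurableType d) (R : realType) (P : probability T R)
    (f : R -> T -> R) (W G : T -> R) (a b : R) :
  (forall l, measurable_fun setT (f l)) ->
  P.-integrable setT (EFin \o W) -> P.-integrable setT (EFin \o G) ->
  0 < \int[P]_w (W w)%:E -> (0 <= b)%R -> (b < a)%R ->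
  (forall l w, (1 <= l)%R -> (l `^ a * W w - l `^ b * G w <= f l w)%R) ->
  'E_P[f l] @[l --> +oo%R] --> +oo.
Proof.
move=> mf iW iG W0 b0 ba fl; apply/cvgeyPge => A.
have fW := integrable_fin_num measurableT iW.
have fG := integrable_fin_num measurableT iG.
pose c := fine (\int[P]_w (W w)%:E); pose D := fine (\int[P]_w (G w)%:E).
have c0 : (0 < c)%R by rewrite fine_gt0// W0 ltey_eq fW.
have h := @near_pinfty_powR_sub_ge R c D a b A c0 b0 ba.
near=> l.
have l1 : (1 <= l)%R by near: l; apply: nbhs_pinfty_ge; rewrite num_real.
have hl : (A <= l `^ a * c - l `^ b * D)%R by near: l.
have iaW := integrableZl measurableT (l `^ a) iW.
have ibG := integrableZl measurableT (l `^ b) iG.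
apply: (@le_trans _ _ (\int[P]_w ((l `^ a)%:E * (W w)%:E -
                                  (l `^ b)%:E * (G w)%:E))).
  rewrite (integralB measurableT iaW ibG) (integralZl measurableT iW).
  rewrite (integralZl measurableT iG) -(fineK fW) -(fineK fG).
  by rewrite -!EFinM -EFinB lee_fin.
rewrite unlock; apply: integral_le_integrable_minorant => //.
- exact: integrableB.
- exact/measurable_EFinP.
- by move=> w _; rewrite -!EFinM -EFinB lee_fin fl.
Unshelve. all: by end_near. Qed.

(** A nonnegative function with zero integral vanishes almost everywhere, but the truncation is
    positive wherever [X] is, hence on a set of positive probability. *)
Lemma integral_truncation_gt0 (d : measure_display) (T : measurableType d)
    (R : realType) (P : probability T R) (X : {RV P >-> R}) :
  0 < P [set w | (0 < X w)%R] ->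
  0 < \int[P]_w (Num.min (Num.max (X w) 0) 1)%:E.
Proof.
set W := fun w => Num.min (Num.max (X w) 0%R) 1%R => X0.
have mW : measurable_fun setT (EFin \o W).
  by apply/measurable_EFinP; apply: measurable_minr => //;
     apply: measurable_maxr.
have W0 w : (0 <= W w)%R by rewrite le_min le_max lexx orbT ler01.
rewrite lt_neqAle; apply/andP; split; last first.
  by apply: integral_ge0 => w _; rewrite lee_fin W0.
apply/eqP => I0.
have : \int[P]_w `|(EFin \o W) w| = 0.
  by rewrite [RHS]I0; apply: eq_integral => w _; rewrite /= ger0_norm.
move/(ae_eq_integral_abs P measurableT mW) => [N [mN N0 sN]].
suff : P [set w | (0 < X w)%R] <= P N by rewrite N0 leNgt X0.
apply: le_measure; rewrite ?inE//.
  have -> : [set w | (0 < X w)%R] = setT `&` X @^-1` `]0%R, +oo[.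
    by apply/seteqP; split => w /=; rewrite in_itv /= andbT; [|case].
  exact: (measurable_funP X).
move=> w /= Xw; apply: sN => /= /(_ I) [] /eqP.
by rewrite gt_eqF// lt_min ltr01 lt_max Xw.
Qed.

Lemma integrable_truncation (d : measure_display) (T : measurableType d)
    (R : realType) (P : probability T R) (X : {RV P >-> R}) :
  P.-integrable setT (EFin \o (fun w => Num.min (Num.max (X w) 0) 1)%R).
Proof.
apply: (le_integrable measurableT _ _
  (finite_measure_integrable_cst P 1%R measurableT)).
  by apply/measurable_EFinP; apply: measurable_minr => //;
     apply: measurable_maxr.
move=> w _ /=; rewrite lee_fin normr1 ger0_norm; last first.
  by rewrite le_min le_max lexx orbT ler01.
by rewrite ge_min lexx orbT.
Qed.

(* With [t := W - |y| / l <= 1] one has [((y + l x) / l)^+ >= t], and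
   [t <= t^a] as soon as [t > 0]. *)
Lemma powR_pos_part_ge {R : realType} (a l x y : R) :
  (0 < a)%R -> (a <= 1)%R -> (1 <= l)%R ->
  (l `^ a * Num.min (Num.max x 0) 1 - `|y| <=
   (Num.max (y + l * x) 0) `^ a)%R.
Proof.
move=> a0 a1 l1; set W := Num.min _ _.
have l0 : (0 < l)%R by lra.
have la0 : (0 <= l `^ a)%R by exact: powR_ge0.
have lal : (l `^ a / l <= 1)%R by rewrite ler_pdivrMr// mul1r ler1_powR.
have W1 : (W <= 1)%R by rewrite ge_min lexx orbT.
have yl0 : (0 <= `|y| / l)%R by rewrite divr_ge0// ltW.
pose t := (W - `|y| / l)%R.
(* Replacing [|y|] by [l^a * (|y| / l)] only decreases the loss, since [a <= 1] gives
   [l^a / l <= 1]. *)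
apply: (@le_trans _ _ (l `^ a * t)%R).
  rewrite /t mulrBr mulrCA lerB// ler_piMr//.
have [t0|t0] := leP t 0%R.
  by apply: (@le_trans _ _ 0%R); [rewrite mulr_ge0_le0|rewrite powR_ge0].
(* For [x <= 0] the truncation is 0 and [t <= 0]. So [x > 0], hence [W <= x], which yields
   [l * t <= y + l * x]. *)
have x0 : (0 < x)%R.
  rewrite ltNge; apply/negP => x0; move: t0.
  by rewrite /t /W (max_idPr x0) min_l ?ler01// => t0; lra.
have Wx : (W <= x)%R by rewrite /W (max_idPl (ltW x0)) ge_min lexx.
apply: (@le_trans _ _ ((l * t) `^ a)%R).
  rewrite powRM ?(ltW l0) ?(ltW t0)// ler_wpM2l// ger1_powR// t0 /=.
  by rewrite /t; lra.
have lt0 : (0 <= l * t)%R by rewrite mulr_ge0// ltW.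
apply: ge0_ler_powR; rewrite ?nnegrE ?le_max ?lexx ?orbT ?(ltW a0)//.
have -> : (l * t = l * W - `|y|)%R.
  by rewrite /t mulrBr mulrCA divff ?gt_eqF// mulr1.
apply/orP; left.
have := ler_norm (- y); rewrite normrN.
have : (l * W <= l * x)%R by rewrite ler_pM2l.
lra.
Qed.

(** Gains and losses are bounded separately. The negative part of [y + l * x] is at most [l * S]
    with [S = 1 + |y| + x^-]; the summand 1 ensures [S >= 1], so that [S^a2 <= S] and the bound is
    linear in [|y|] and [x^-]. *)
Lemma power_utility_ge {R : realType} (C1 C2 a1 a2 l x y : R) :
  (0 < C1)%R -> (0 <= C2)%R -> (0 < a2)%R -> (a2 < a1)%R -> (a1 <= 1)%R ->
  (1 <= l)%R ->
  (l `^ a1 * (C1 * Num.min (Num.max x 0) 1) -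
   l `^ a2 * (C1 * `|y| + C2 * (1 + `|y| + Num.max (- x) 0)) <=
   power_utility C1 a1 C2 a2 (y + l * x))%R.
Proof.
move=> C10 C20 a20 a21 a11 l1.
have l0 : (0 < l)%R by lra.
have a10 : (0 < a1)%R by lra.
have la2 : (1 <= l `^ a2)%R by rewrite -(powRr0 l) ler_powR// ltW.
set v := (y + l * x)%R; set W := Num.min _ _; set S := (1 + _ + _)%R.
have xN0 : (0 <= Num.max (- x) 0)%R by rewrite le_max lexx orbT.
have S1 : (1 <= S)%R by rewrite /S; have := normr_ge0 y; lra.
have pos : (l `^ a1 * W - `|y| <= (Num.max v 0) `^ a1)%R.
  exact: powR_pos_part_ge.
have neg : ((Num.max (- v) 0) `^ a2 <= l `^ a2 * S)%R.
  apply: (@le_trans _ _ ((l * S) `^ a2)%R); last first.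
    rewrite powRM ?(ltW l0) ?(le_trans ler01 S1)//.
    by rewrite ler_wpM2l ?powR_ge0// ler1_powR//; lra.
  have lS0 : (0 <= l * S)%R by rewrite mulr_ge0 ?(ltW l0) ?(le_trans ler01 S1).
  apply: ge0_ler_powR; rewrite ?nnegrE ?le_max ?lexx ?orbT ?(ltW a20)//.
  rewrite ge_max lS0 andbT /v /S !mulrDr mulr1.
  have := ler_norm (- y); rewrite normrN => yN.
  have : (`|y| <= l * `|y|)%R by rewrite ler_peMl.
  have : (l * - x <= l * Num.max (- x) 0)%R.
    by rewrite ler_pM2l// le_max lexx.
  lra.
(* One formula covers both signs: the part of [v] that vanishes contributes 0, as both exponents are
   nonzero ([powR] gives 1 at exponent 0). *)
have -> : power_utility C1 a1 C2 a2 v =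
    (C1 * (Num.max v 0) `^ a1 - C2 * (Num.max (- v) 0) `^ a2)%R.
  rewrite /power_utility; case: ifPn => [v0|].
    by rewrite (max_idPl v0) max_r ?oppr_le0// powR0 ?gt_eqF// mulr0 subr0.
  rewrite -ltNge => v0; rewrite (max_idPr (ltW v0)) max_l ?oppr_ge0 ?ltW//.
  by rewrite powR0 ?gt_eqF// mulr0 sub0r.
have : (C1 * (l `^ a1 * W - `|y|) <= C1 * (Num.max v 0) `^ a1)%R.
  by rewrite ler_pM2l.
have : (C2 * (Num.max (- v) 0) `^ a2 <= C2 * (l `^ a2 * S))%R.
  by rewrite ler_wpM2l.
(* The error [|y|] from the gain estimate is charged to the [l^a2] term. *)
have : (C1 * `|y| <= l `^ a2 * (C1 * `|y|))%R.
  by rewrite ler_peMl// mulr_ge0// ltW.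
lra.
Qed.

Lemma measurable_power_utility {R : realType} (C1 a1 C2 a2 : R) :
  measurable_fun setT (power_utility C1 a1 C2 a2).
Proof.
apply: measurable_fun_ifT.
- exact: measurable_fun_ler.
- by apply: measurable_funM => //; exact: measurable_powR.
- apply: measurableT_comp => //; apply: measurable_funM => //.
  apply: (measurableT_comp (measurable_powR _)).
  exact: oppr_measurable.
Qed.

Lemma L0_sublinear_add_scale_le (d : measure_display)
    (Omega : measurableType d) (R : realType) (P : probability Omega R)
    (F : L0_functional P) (X Y : {RV P >-> R}) (l : R) :
  L0_positive_homogeneous F -> L0_subadditive F -> F (L0_class X) <= 0 ->
  (0 <= l)%R -> F (L0_class (Y + l *: X)%R) <= F (L0_class Y).
Proof.
move=> hom sub FX l0; apply: (le_trans (sub _ _)).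
rewrite hom// -[leRHS]adde0 leeD2l//.
by rewrite mule_ge0_le0 ?lee_fin.
Qed.

Theorem theorem1p5 (d : measure_display) (Omega : measurableType d)
    (R : realType) (P : probability Omega R) (price rho : L0_functional P)
    (hrho : coherent_risk_measure rho) (hprice : coherent_market price)
    (X : {RV P >-> R}) (hX : rho_arbitrage price rho X) :
  (forall Y : {RV P >-> R}, (Y : Omega -> R) \in Lfun P 1 ->
    ('E_P[fun w => tilde_u (Y w + lambda * X w)%R]
       @[lambda --> +oo%R] --> +oo) /\
    (forall lambda : R, (0 <= lambda)%R ->
      price (L0_class (Y + lambda *: X)%R) <= price (L0_class Y) /\
      rho (L0_class (Y + lambda *: X)%R) <= rho (L0_class Y))) /\
  ('E_P[X^\-%R] < +oo ->
   forall Y : {RV P >-> R}, (Y : Omega -> R) \in Lfun P 1 ->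
   forall C1 C2 a1 a2 : R,
     (0 < C1)%R -> (0 <= C2)%R -> (0 < a2)%R -> (a2 < a1)%R -> (a1 <= 1)%R ->
     'E_P[fun w => power_utility C1 a1 C2 a2 (Y w + lambda * X w)%R]
       @[lambda --> +oo%R] --> +oo).
Proof.
have [pX rX X0] := hX.
have iW := integrable_truncation _ _ _ P X.
have W0 := integral_truncation_gt0 _ _ _ P X X0.
have mYX (Y : {RV P >-> R}) l : measurable_fun setT (fun w => Y w + l * X w)%R.
  by apply: measurable_funD => //; exact: measurable_funM.
split => [Y|XN Y] /Lfun1_integrable iY; have iYn := integrable_norm iY.
  split => [|l l0]; last first.
    by split; apply: L0_sublinear_add_scale_le => //; case: hprice; case: hrho.
  (* With exponents 1 and 0 the minorant is [l * W - |Y|], which does not involve [X^-]. *)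
  apply: (@cvg_expectation_powR_minorant _ _ _ P _ _ _ 1%R 0%R _ iW iYn) => //.
    by move=> l; apply: measurable_maxr.
  move=> l w l1; rewrite powRr0 mul1r.
  have := @powR_pos_part_ge R 1 l (X w) (Y w) ltr01 (lexx _) l1.
  by rewrite (@powRr1 _ (Num.max _ _)) ?le_max ?lexx ?orbT.
move=> C1 C2 a1 a2 C10 C20 a20 a21 a11.
have iXN : P.-integrable setT (EFin \o X^\-%R).
  apply/integrableP; split; first exact/measurable_EFinP/measurable_funrneg.
  rewrite unlock in XN; apply: le_lt_trans XN.
  by under eq_integral do rewrite /= ger0_norm ?funrneg_ge0//.
have i1 := finite_measure_integrable_cst P 1%R measurableT.
have iS := integrableD measurableT (integrableD measurableT i1 iYn) iXN.
(* This is the coefficient of [l^a2] in [power_utility_ge]; its integrability rests on that of [|Y|]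
   and [X^-]. *)
have iG := integrableD measurableT (integrableZl measurableT C1 iYn)
  (integrableZl measurableT C2 iS).
apply: (@cvg_expectation_powR_minorant _ _ _ P _ _ _ a1 a2 _
  (integrableZl measurableT C1 iW) iG) => //.
- by move=> l; apply: measurableT_comp => //; exact: measurable_power_utility.
- under eq_integral do rewrite EFinM.
  by rewrite (integralZl measurableT iW) mule_gt0 ?lte_fin.
- exact: ltW.
- by move=> l w l1; apply: power_utility_ge.
Qed.
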